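(* Let $f(n)$ be the largest integer such that every poset on $n$ elements has a subposet on $f(n)$ elements of dimension at most $2$. Then \[ f(n) \leq 4n^{2/3} + o\left(n^{2/3}\right) \quad (n\to\infty). \]
   Context: A subposet of a poset $P$ is a subset of its ground set with the order induced from $P$. The dimension $\dim(P)$ of a poset $P$ is the least integer $d$ such that there are $d$ linear extensions of $P$ whose intersection is $P$ (equivalently, the least $d$ such that $P$ embeds into $\mathbb{R}^d$ with the product order, i.e. $x<y$ in $P$ iff the image of $x$ is coordinatewise below the image of $y$). *)

(* Defs.v *)
From mathcomp Require Import all_boot.
From Stdlib Require Import Reals.
Set Implicit Arguments.
Unset Strict Implicit.
Unset Printing Implicit Defensive.

Definition is_poset (T : finType) (le : rel T) : Prop :=
  [/\ reflexive le, antisymmetric le & transitive le].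

Definition linear_extension_on (T : finType) (le : rel T) (S : {set T}) (L : rel T) : Prop :=
  [/\ {in S, reflexive L},
      {in S &, antisymmetric L},
      {in S & &, transitive L},
      {in S &, total L} &
      {in S &, forall x y, le x y -> L x y}].

Definition realizer_of_size (T : finType) (le : rel T) (S : {set T}) (d : nat) : Prop :=
  exists Ls : 'I_d -> rel T,
    (forall i, linear_extension_on le S (Ls i)) /\
    {in S &, forall x y, le x y = [forall i, Ls i x y]}.

Definition dim_at_most (T : finType) (le : rel T) (S : {set T}) (k : nat) : Prop :=
  exists2 d, d <= k & realizer_of_size le S d.

(* Every poset on n elements has a subposet on k elements of dimension <= 2.
   f(n) is the largest k with this property. *)
Definition every_poset_has_dim2_subposet (n k : nat) : Prop :=
  forall le : rel 'I_n, is_poset le ->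
    exists S : {set 'I_n}, #|S| = k /\ dim_at_most le S 2.

(* Main.v *)
(** The host poset lives on a cube of side [m], with [a < b] iff [z a < z b] and
    either [y a < y b], or [a] and [b] agree in [x] and [y].  Let [S] be a subposet
    of more than [4 m^2] points.  Deleting the lowest point of [S] on each vertical
    line and the point with largest [y] on each line parallel to the [y]-axis
    removes at most [2 m^2] points, so three of the remaining points, [b0], [b1] and
    [b2], lie on a common line parallel to the [x]-axis.  Let [a_i] be a point of [S]
    vertically below [b_i], and [c] a point of [S] beyond [b0] in the direction [y].
    The comparabilities between these points are [a_i < b_i] and [a_i < c], and this
    spider has dimension 3. *)
Require Import Defs.
From mathcomp Require Import all_boot.
From Stdlib Require Import Reals Lra.

Local Notation "m ^ n" := (expn m n) : nat_scope.

(** * Dimension at most 2 and the spider *)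

(** The pair [x0], [y0] rules out the empty realizer, whose intersection relates everything; a
    realizer with a single order uses that order twice. *)
Lemma dim2_realizer {T : finType} {le : rel T} {S : {set T}} {x0 y0 : T} :
  x0 \in S -> y0 \in S -> ~~ le x0 y0 -> dim_at_most le S 2 ->
  exists L1 L2 : rel T,
    [/\ linear_extension_on le S L1, linear_extension_on le S L2
      & {in S &, forall x y, le x y = L1 x y && L2 x y}].
Proof.
move=> Sx0 Sy0 nle [[|[|[|d]]] // _ [Ls [linL leL]]].
- by rewrite leL // in nle; case/negP: nle; apply/forallP; case.
- exists (Ls ord0), (Ls ord0); split=> // x y Sx Sy.
  rewrite leL // andbb; apply/forallP/idP => [/(_ ord0) //| Lxy i].
  by rewrite (ord1 i).
- exists (Ls ord0), (Ls (lift ord0 ord0)); split=> // x y Sx Sy.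
  rewrite leL //; apply/forallP/andP => [L | [L0 L1] i]; first by split.
  by case: (unliftP ord0 i) => [j|] ->; rewrite // (ord1 j).
Qed.

(* If [b0] and [b1] lie on the same side of [c] in both linear orders, then in the
   order [L1] that puts them below [c] we get [b1 < a0 <= b0 < a1 <= b1]. *)
Lemma same_side_contradiction {T : finType} {le : rel T} {S : {set T}}
    {L1 L2 : rel T} {c a0 a1 b0 b1 : T} :
    linear_extension_on le S L1 -> linear_extension_on le S L2 ->
    {in S &, forall x y, le x y = L1 x y && L2 x y} ->
    c \in S -> a0 \in S -> a1 \in S -> b0 \in S -> b1 \in S ->
    le a0 c -> le a1 c -> le a0 b0 -> le a1 b1 ->
    ~~ le a0 b1 -> ~~ le a1 b0 ->
  L2 c b0 -> L2 c b1 -> False.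
Proof.
move=> [_ anti1 trans1 tot1 ext1] [_ _ trans2 _ ext2] leE.
move=> Sc Sa0 Sa1 Sb0 Sb1 a0c a1c a0b0 a1b1 a0b1 a1b0 cb0 cb1.
have L2ab a b : a \in S -> b \in S -> le a c -> L2 c b -> L2 a b.
  by move=> Sa Sb ac; apply: trans2 => //; apply: ext2.
have L1ba a b : a \in S -> b \in S -> le a c -> L2 c b -> ~~ le a b -> L1 b a.
  move=> Sa Sb ac cb; rewrite leE // (L2ab a b) // andbT => /negbTE nL.
  by have := tot1 a b Sa Sb; rewrite nL.
have b1a0 : L1 b1 a0 by apply: L1ba.
have b0a1 : L1 b0 a1 by apply: L1ba.
have a0a1 : L1 a0 a1 by apply: (trans1 b0) => //; apply: ext1.
have a1a0 : L1 a1 a0 by apply: (trans1 b1) => //; apply: ext1.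
have eq_a : a0 = a1 by apply: anti1 => //; rewrite a0a1.
by rewrite eq_a a1b1 in a0b1.
Qed.

(** Each [b i] is incomparable to [c], so it lies above [c] in exactly one of the two orders. By
    pigeonhole two of the three lie above [c] in the same order. *)
Lemma spider_not_dim2 {T : finType} {le : rel T} {S : {set T}}
    {c : T} {a b : 'I_3 -> T} :
    c \in S -> (forall i, a i \in S) -> (forall i, b i \in S) ->
    (forall i, le (a i) c) -> (forall i, le (a i) (b i)) ->
    (forall i j, i != j -> ~~ le (a i) (b j)) ->
    (forall i, ~~ le c (b i)) -> (forall i, ~~ le (b i) c) ->
  ~ dim_at_most le S 2.
Proof.
move=> Sc Sa Sb ac ab nab ncb nbc dim2.
have [L1 [L2 [lin1 lin2 leE]]] := dim2_realizer Sc (Sb ord0) (ncb ord0) dim2.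
have leE' : {in S &, forall x y, le x y = L2 x y && L1 x y}.
  by move=> x y Sx Sy; rewrite leE // andbC.
have side i : L1 c (b i) != L2 c (b i).
  have [_ _ _ tot1 _] := lin1; have [_ _ _ tot2 _] := lin2.
  have := ncb i; have := nbc i; rewrite !leE //.
  have := tot1 c (b i) Sc (Sb i); have := tot2 c (b i) Sc (Sb i).
  by do 4?case: (_ (_ : T) (_ : T)).
have /injectivePn [i [j ij eq_side]] : ~~ injectiveb (fun i => L2 c (b i)).
  by apply/injectiveP => /leq_card; rewrite card_bool card_ord.
have ji : j != i by rewrite eq_sym.
case cbi: (L2 c (b i)) eq_side => /esym cbj.
- exact: (same_side_contradiction lin1 lin2 leE Sc (Sa i) (Sa j) (Sb i) (Sb j)
    (ac i) (ac j) (ab i) (ab j) (nab _ _ ij) (nab _ _ ji)).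
- have := side i; have := side j; rewrite cbi cbj !eqbF_neg !negbK => cbj1 cbi1.
  exact: (same_side_contradiction lin2 lin1 leE' Sc (Sa i) (Sa j) (Sb i) (Sb j)
    (ac i) (ac j) (ab i) (ab j) (nab _ _ ij) (nab _ _ ji)).
Qed.

(** * Counting in the cube poset *)

Lemma leq_card_fibers {T U : finType} {A : {set T}} (f : T -> U) (d : nat) :
  (forall u, #|[set a in A | f a == u]| <= d) -> #|A| <= d * #|U|.
Proof.
move=> fib_le; rewrite -sum1_card (partition_big f predT) //=.
rewrite mulnC -sum_nat_const; apply: leq_sum => u _.
apply: leq_trans (fib_le u); rewrite -sum1_card.
by under [leqRHS]eq_bigl do rewrite inE.
Qed.

Section Cube.

Variables (T : finType) (m : nat) (x y z : T -> 'I_m).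
Hypothesis xyz_inj : injective (fun t => (x t, y t, z t)).

Definition cube_le : rel T := fun s t =>
  (s == t) || (z s < z t) && ((y s < y t) || (x s == x t) && (y s == y t)).

Lemma cube_le_poset : is_poset cube_le.
Proof.
rewrite /cube_le; split.
- by move=> s; rewrite eqxx.
- move=> s t /andP [/orP [/eqP // | /andP [zst _]]].
  by case/orP=> [/eqP // | /andP [zts _]]; have := ltn_trans zst zts; rewrite ltnn.
- move=> t s u /orP [/eqP -> // | /andP [zst yst]] /orP [/eqP <- | /andP [ztu ytu]].
    by rewrite zst yst orbT.
  rewrite (ltn_trans zst ztu) /=; apply/orP; right.
  case/orP: yst => [yst | /andP [/eqP -> /eqP ->]] //.
  case/orP: ytu => [ytu | /andP [_ /eqP <-]]; last by rewrite yst.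
  by rewrite (ltn_trans yst ytu).
Qed.

(** The points left out minimize [g] on their fiber of [f]; each of the [m ^ 2] fibers has at most
    one, since [g] is injective there. *)
Lemma leq_card_non_extremal (S : {set T}) (f : T -> 'I_m * 'I_m) (g : T -> nat) :
    {in S &, forall s t, f s = f t -> g s = g t -> s = t} ->
  #|S| <= #|[set s in S | [exists t in S, (f t == f s) && (g t < g s)]]| + m ^ 2.
Proof.
move=> fg_inj; set A := [set s in S | _].
rewrite -(cardsID A S) leq_add ?subset_leq_card ?subsetIr //.
have -> : m ^ 2 = 1 * #|{: 'I_m * 'I_m}| by rewrite card_prod card_ord mul1n.
apply: (leq_card_fibers f) => u; apply/card_le1_eqP => s t.
rewrite !inE => /andP [/andP [nAs Ss] /eqP fs] /andP [/andP [nAt St] /eqP ft].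
move: nAs nAt; rewrite Ss St /= !negb_exists => /forallP /(_ t) + /forallP /(_ s).
rewrite Ss St /= fs ft eqxx /= -!leqNgt => gst gts.
by apply: fg_inj => //; [rewrite fs ft | apply/eqP; rewrite eqn_leq gst gts].
Qed.

Lemma leq_card_cube_dim2 (S : {set T}) :
  dim_at_most cube_le S 2 -> #|S| <= 4 * m ^ 2.
Proof.
move=> dim2.
have xyz_eq s t : x s = x t -> y s = y t -> z s = z t -> s = t.
  by move=> xst yst zst; apply: xyz_inj; rewrite xst yst zst.
have subn_ord_inj n (i j : 'I_n) : n - i = n - j -> i = j.
  move=> eq_ij; apply/val_inj/eqP.
  by rewrite -(eqn_add2r (n - i)) {2}eq_ij !subnKC // ltnW // ltn_ord.
set A := [set s in S | [exists t in S, ((x t, y t) == (x s, y s)) && (z t < z s)]].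
(* Subtracting from [m] turns the largest [y] into a minimum, so that [leq_card_non_extremal]
   applies again. *)
set B := [set s in A |
  [exists t in A, ((x t, z t) == (x s, z s)) && (m - y t < m - y s)]].
have cardA : #|S| <= #|A| + m ^ 2.
  apply: leq_card_non_extremal => s t _ _ [xst yst] /val_inj; exact: xyz_eq.
have cardB : #|A| <= #|B| + m ^ 2.
  apply: leq_card_non_extremal => s t _ _ [xst zst] /subn_ord_inj yst; exact: xyz_eq.
suff cardB2 : #|B| <= 2 * m ^ 2.
  apply: leq_trans cardA _; apply: leq_trans (leq_add cardB (leqnn _)) _.
  by rewrite -addnA addnn -mul2n -[4]/(2 + 2) mulnDl leq_add2r.
have -> : m ^ 2 = #|{: 'I_m * 'I_m}| by rewrite card_prod card_ord.
(* The fibers are the lines parallel to the [x]-axis; three points of [B] on one of them would span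
   a spider. *)
apply: (leq_card_fibers (fun t => (y t, z t))) => [[v w]].
rewrite leqNgt; apply/negP; set F := [set s in B | _] => ltF.
pose b (i : 'I_3) := enum_val (widen_ord ltF i).
have b_inj : injective b by move=> i j /enum_val_inj /(congr1 val) /= /val_inj.
have Fb i : [/\ b i \in B, y (b i) = v & z (b i) = w].
  have := enum_valP (widen_ord ltF i).
  by rewrite -/(b i) inE => /andP [-> /eqP [-> ->]].
have Ab i : b i \in A by have [] := Fb i; rewrite inE => /andP [].
have Sb i : b i \in S by have := Ab i; rewrite inE => /andP [].
have xb i j : i != j -> x (b i) != x (b j).
  apply: contraNneq => xbij; apply/eqP/b_inj/xyz_eq => //.
    by have [_ -> _] := Fb i; have [_ -> _] := Fb j.
  by have [_ _ ->] := Fb i; have [_ _ ->] := Fb j.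
have below i : {t | t \in S & [/\ x t = x (b i), y t = v & z t < w]}.
  have [_ ybi zbi] := Fb i.
  have /sig2W : exists2 t, t \in S & [&& x t == x (b i), y t == v & z t < w].
    have := Ab i; rewrite inE => /andP [_ /exists_inP [t St]].
    rewrite ybi zbi => /andP [/eqP [xt yt] zt]; exists t => //.
    by rewrite xt yt zt !eqxx.
  by case=> t St /and3P [/eqP xt /eqP yt zt]; exists t.
pose a i := s2val (below i).
have Sa i : a i \in S by rewrite /a; case: (below i).
have aP i : [/\ x (a i) = x (b i), y (a i) = v & z (a i) < w].
  by rewrite /a; case: (below i).
have [c Sc [yc zc]] : exists2 c, c \in S & v < y c /\ z c = w.
  have [] := Fb ord0; rewrite inE => /andP [_ /exists_inP [c]].
  rewrite inE => /andP [Sc _] + yb zb; rewrite yb zb => /andP [/eqP [_ zc] yc].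
  exists c => //; split=> //; rewrite ltnNge; apply: contraL yc => yc.
  by rewrite -leqNgt leq_sub2l.
apply: (@spider_not_dim2 _ cube_le S c a b) dim2 => // [i | i | i j ij | i | i].
all: rewrite /cube_le.
- by have [_ ya za] := aP i; rewrite ya zc za yc orbT.
- have [xa ya za] := aP i; have [_ yb zb] := Fb i.
  by rewrite xa ya yb zb za !eqxx !orbT.
(* Here [a i] and [b j] have equal [y] but different [x], so neither alternative in [cube_le]
   holds. *)
- have [xa ya za] := aP i; have [_ yb zb] := Fb j.
  rewrite xa ya yb (negbTE (xb _ _ ij)) ltnn andbF orbF.
  by apply: contraTneq za => ->; rewrite zb ltnn.
(* In both remaining goals the points are distinct and of equal height [w], hence incomparable. *)
- have [_ yb zb] := Fb i; rewrite zc zb ltnn orbF.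
  by apply: contraTneq yc => ->; rewrite yb ltnn.
- have [_ yb zb] := Fb i; rewrite zc zb ltnn orbF.
  by apply: contraTneq yc => <-; rewrite yb ltnn.
Qed.

End Cube.

Lemma dim2_subposet_bound (n m k : nat) :
  n <= m ^ 3 -> every_poset_has_dim2_subposet n k -> k <= 4 * m ^ 2.
Proof.
case: m => [|m].
  (* With side 0 there are no elements, and any relation on the empty type is a poset. *)
  rewrite leqn0 => /eqP -> /(_ (fun _ _ => true)) [|S [<- _]].
    by split=> [[]|[]|[]].
  by rewrite (leq_trans (max_card _)) ?card_ord.
move=> n_le dim2_sub.
(* The coordinates are the digits of [i] in base [m.+1]. The top one is not reduced; it fits because
   [n] is at most the cube of the base. *)
pose x (i : 'I_n) : 'I_m.+1 := inord (i %% m.+1).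
pose y (i : 'I_n) : 'I_m.+1 := inord (i %/ m.+1 %% m.+1).
pose z (i : 'I_n) : 'I_m.+1 := inord (i %/ m.+1 %/ m.+1).
have xyz_inj : injective (fun i => (x i, y i, z i)).
  move=> i j [/(congr1 val) xij /(congr1 val) yij /(congr1 val) zij].
  have zlt (t : 'I_n) : t %/ m.+1 %/ m.+1 < m.+1.
    rewrite !ltn_divLR // (leq_trans (ltn_ord t)) // (leq_trans n_le) //.
    by rewrite !expnS muln1 mulnA.
  rewrite /= !inordK ?ltn_pmod // in xij yij zij.
  apply: val_inj => /=.
  by rewrite (divn_eq i m.+1) (divn_eq (i %/ m.+1) m.+1) xij yij zij -!divn_eq.
have [S [<- dim2]] := dim2_sub _ (cube_le_poset _ _ x y z).
exact: leq_card_cube_dim2 _ _ _ _ _ xyz_inj _ dim2.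
Qed.

(** * Asymptotics *)

Lemma Rpower_third_cube (n : R) : (0 < n)%R ->
  (Rpower n (1 / 3) * Rpower n (1 / 3) * Rpower n (1 / 3) = n)%R.
Proof.
move=> n_gt0; rewrite -!Rpower_plus.
by rewrite (_ : (1 / 3 + 1 / 3 + 1 / 3 = 1)%R) ?Rpower_1 //; field.
Qed.

Lemma Rcube_lt (s t : R) : (0 <= s)%R -> (s * s * s < t * t * t)%R -> (s < t)%R.
Proof.
move=> s_ge0 lt_cube; apply: Rnot_le_lt => ts.
have [t0 | t0] := Rle_or_lt t 0; first by nra.
have : (t * t <= s * s)%R by nra.
by nra.
Qed.

(** For the least [m] with [n <= m ^ 3], the cube of [m - 1] is below [n]. *)
Lemma cube_side (n : nat) : (0 < n)%N ->
  exists m, (n <= m ^ 3)%N /\ (INR m <= Rpower (INR n) (1 / 3) + 1)%R.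
Proof.
move=> n_gt0.
have exm : exists m, n <= m ^ 3 by exists n; rewrite -{1}(expn1 n) leq_pexp2l.
have [[|m] n_le minm] := ex_minnP exm; first by rewrite leqNgt n_gt0 in n_le.
exists m.+1; split=> //; rewrite S_INR; apply/Rplus_le_compat_r/Rlt_le/Rcube_lt.
  exact: pos_INR.
rewrite Rpower_third_cube; last exact/lt_0_INR/ltP.
rewrite -!mult_INR; apply/lt_INR/ltP.
have : ~~ (n <= m ^ 3) by apply/negP => /minm; rewrite ltnn.
by rewrite -ltnNge !expnS muln1 mulnA.
Qed.

(* f(n) <= 4 n^(2/3) + o(n^(2/3)):  for every eps > 0, eventually every k such that
   every n-element poset has a k-element subposet of dimension <= 2 (i.e. every
   k <= f(n)) satisfies k <= (4 + eps) n^(2/3). *)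
Theorem theorem1 :
  forall eps : R, (0 < eps)%R ->
  exists N : nat, forall n : nat, (N <= n)%N ->
  forall k : nat, every_poset_has_dim2_subposet n k ->
    (INR k <= (4 + eps) * Rpower (INR n) (2 / 3))%R.
Proof.
move=> eps eps_gt0.
(* With [r] the cube root of [n], the bound is [4 (r + 1)^2 = 4 r^2 + 8 r + 4]. For [r > 1] this is
   at most [4 r^2 + 12 r], and [r > 12 / eps] gives [12 r <= eps r^2]. *)
pose C := (1 + 12 / eps)%R.
have C_gt1 : (0 < 12 / eps)%R by apply: Rdiv_lt_0_compat; lra.
have [N C_lt] := INR_unbounded (C * C * C).
exists N.+1 => n N_lt k dim2_sub.
have n_gt0 : 0 < n by apply: leq_trans N_lt.
have [m [n_le m_le]] := cube_side n n_gt0.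
have nR_gt0 : (0 < INR n)%R by apply/lt_0_INR/ltP.
have k_le : (INR k <= 4 * (INR m * INR m))%R.
  have /leP/le_INR := dim2_subposet_bound n m k n_le dim2_sub.
  by rewrite !mult_INR /=; lra.
have r_gt : (C < Rpower (INR n) (1 / 3))%R.
  apply: Rcube_lt; first by rewrite /C; lra.
  rewrite Rpower_third_cube //; apply: Rlt_le_trans C_lt _.
  exact/le_INR/leP/ltnW.
have -> : (2 / 3 = 1 / 3 + 1 / 3)%R by field.
rewrite Rpower_plus.
move: r_gt m_le; set r := Rpower _ _; rewrite /C => r_gt m_le.
have eps_r : (12 < eps * r)%R.
  have -> : (12 = eps * (12 / eps))%R by field; lra.
  by apply: Rmult_lt_compat_l => //; lra.
have m_ge0 := pos_INR m.
have : (INR m * INR m <= (r + 1) * (r + 1))%R by nra.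
have : (12 * r <= eps * r * r)%R by nra.
by nra.
Qed.
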